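(* Let $\mathcal{I}$ be an ideal on a countable set. The following are equivalent: (1) $\mathcal{I}$ is not weakly Ramsey; (2) $\mathcal{WR}\sqsubseteq\mathcal{I}$; (3) $\mathcal{WR}\leq_{K}\mathcal{I}$.
   Context: An ideal on a countable set $X$ is a collection $\mathcal{I}\subset\mathcal{P}(X)$ closed under subsets and finite unions, with $\mathcal{I}\neq\mathcal{P}(X)$ and containing all finite subsets of $X$ (so $X=\bigcup\mathcal{I}$ is infinite). $\mathcal{I}^*=\{A\subset X: X\setminus A\in\mathcal{I}\}$ is the dual filter; a set $A\subset X$ is $\mathcal{I}$-positive if $A\notin\mathcal{I}$. A family $\mathcal{G}$ generates $\mathcal{I}$ if $\mathcal{I}$ consists of all sets covered by finitely many members of $\mathcal{G}$. $\mathcal{WR}$ is the ideal on $\omega\times\omega$ generated by the vertical lines $\{n\}\times\omega$, $n\in\omega$, together with all sets $G\subset\omega\times\omega$ such that for every two distinct points $(i,j),(k,l)\in G$ either $i>k+l$ or $k>i+j$. Orders on ideals: $\mathcal{I}\leq_K\mathcal{J}$ (Katětov order) if there is a function $f:\bigcup\mathcal{J}\to\bigcup\mathcal{I}$ such that $A\in\mathcal{I}$ implies $f^{-1}[A]\in\mathcal{J}$. $\mathcal{I}\sqsubseteq\mathcal{J}$ ($\mathcal{J}$ contains an isomorphic copy of $\mathcal{I}$) if there is such an $f$ which is a bijection. Trees: $X^{<\omega}$ is the set of finite sequences of elements of $X$. A tree is a nonempty set $T\subset X^{<\omega}$ closed under initial segments. The ramification of $T$ at $s\in T$ is $\{x\in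 X: s^\frown(x)\in T\}$. A branch of $T$ is a function $b:\omega\to X$ with $(b(0),\ldots,b(k))\in T$ for all $k\in\omega$; it is called $\mathcal{I}$-positive if its range $b[\omega]$ is $\mathcal{I}$-positive. An ideal $\mathcal{I}$ on $X$ is weakly Ramsey if every tree $T\subset X^{<\omega}$ with all ramifications in $\mathcal{I}^*$ has an $\mathcal{I}$-positive branch. *)

(* Defs.v *)
From mathcomp Require Import all_boot.
From mathcomp Require Import boolp classical_sets functions cardinality.
Set Implicit Arguments.
Unset Strict Implicit.
Unset Printing Implicit Defensive.

Local Open Scope classical_set_scope.

Record is_ideal (X : Type) (I : set (set X)) : Prop := IsIdeal {
  ideal_sub : forall A B, A `<=` B -> I B -> I A;
  ideal_setU : forall A B, I A -> I B -> I (A `|` B);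
  ideal_proper : ~ I [set: X];
  ideal_finite : forall A, finite_set A -> I A
}.

Definition dual_filter (X : Type) (I : set (set X)) : set (set X) :=
  [set A | I (~` A)].

Definition positive (X : Type) (I : set (set X)) (A : set X) : Prop := ~ I A.

Definition generated_by (X : Type) (G : set (set X)) : set (set X) :=
  [set A | exists F : set (set X),
     [/\ finite_set F, F `<=` G & A `<=` \bigcup_(B in F) B]].

Definition vertical_line (n : nat) : set (nat * nat) := [set p | p.1 = n].

Definition WR_scattered (G : set (nat * nat)) : Prop :=
  forall p q, G p -> G q -> p <> q ->
    (q.1 + q.2 < p.1)%N \/ (p.1 + p.2 < q.1)%N.

Definition WR : set (set (nat * nat)) :=
  generated_by (range vertical_line `|` [set G | WR_scattered G]).

Definition katetov_le (X Y : Type) (I : set (set X)) (J : set (set Y)) : Prop :=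
  exists f : Y -> X, forall A, I A -> J (f @^-1` A).

Definition contains_copy (X Y : Type) (I : set (set X)) (J : set (set Y))
    : Prop :=
  exists2 f : Y -> X, bijective f & forall A, I A -> J (f @^-1` A).

Section Trees.
Variable X : eqType.
Implicit Types (T : set (seq X)) (I : set (set X)).

Definition is_tree T : Prop :=
  T !=set0 /\ forall s t, prefix s t -> T t -> T s.

Definition ramification T (s : seq X) : set X := [set x | T (rcons s x)].

Definition is_branch T (b : nat -> X) : Prop := forall k, T (mkseq b k.+1).

Definition weakly_ramsey I : Prop :=
  forall T, is_tree T ->
    (forall s, T s -> dual_filter I (ramification T s)) ->
    exists b, is_branch T b /\ positive I (range b).

End Trees.

(* Main.v *)
Require Import Defs.
From mathcomp Require Import all_boot.
From mathcomp Require Import boolp classical_sets functions cardinality.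

Set Implicit Arguments.
Unset Strict Implicit.
Unset Printing Implicit Defensive.

Local Open Scope classical_set_scope.

(** Call a sequence of points of [nat * nat] climbing if each first coordinate
    exceeds the sum of the two coordinates of every earlier point. A climbing
    sequence has a scattered range, and the points that fail to prolong a given
    finite climbing sequence lie in finitely many vertical lines. Hence, if [f]
    witnesses [katetov_le WR I], the finite sequences with climbing [f]-image
    form a tree whose ramifications are in the dual filter and whose branches
    all have range in [I] ([katetov_le_not_weakly_ramsey]).

    Conversely, let [T] be a tree with ramifications in the dual filter and no
    positive branch. At stage [n] only finitely many nodes of [T] are
    considered, namely those of [words n], and a point is discarded at this
    stage if it fails to prolong one of them; the points of index at most [n]
    in an enumeration of [X] are discarded as well, so that every point
    eventually is. The set discarded at stage [n] is in [I]. Send [x] to the pair of its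
    level, the first stage discarding it, and its index in the enumeration.
    Preimages of vertical lines are in [I] by [ideal_discarded]. A point of
    level above [n] prolongs every node considered at stage [n]; so a climbing
    sequence of images, in which the level of each point beats both the level
    and the index of the previous one, comes from a branch of [T] if its first
    level is positive ([climbing_is_branch]). An infinite scattered set is the range of a
    climbing sequence once it is listed by increasing first coordinate
    ([increasing_enumeration]), hence its preimage is, apart from points of
    level 0, the range of a branch if it is infinite, and so belongs to [I]
    ([ideal_scattered]).

    The map so obtained is injective but not onto. A branch of [T] without
    repetitions provides an infinite set [C] in [I], and the map can be changed
    arbitrarily on a set of [I]: redefining it on [C] as a bijection onto the
    points missed by the image of the complement of [C] gives the copy of [WR]
    ([contains_copy_WR]). *)

(** * Finite unions and preimages in an ideal *)

Section Ideals.
Variables (X : Type) (I : set (set X)).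
Hypothesis hI : is_ideal I.

Lemma ideal_bigcup (J : choiceType) (F : set J) (B : J -> set X) :
  finite_set F -> (forall i, F i -> I (B i)) -> I (\bigcup_(i in F) B i).
Proof.
case/finite_seqP=> s -> {F}; elim: s => [|a s IHs] IB.
  by rewrite set_nil bigcup_set0; apply: (ideal_finite hI).
have -> : [set` a :: s] = a |` [set` s].
  by rewrite predeqE => i; rewrite /= in_cons; split=> /predU1P.
rewrite bigcup_setU1; apply: (ideal_setU hI).
  by apply: IB; rewrite /= mem_head.
by apply: IHs => i /= si; apply: IB; rewrite /= in_cons si orbT.
Qed.

Lemma dual_filter_infinite A : dual_filter I A -> infinite_set A.
Proof.
move=> IA finA; apply: (ideal_proper hI); rewrite -(setUv A).
by apply: (ideal_setU hI) => //; apply: (ideal_finite hI).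
Qed.

(** Membership of preimages in an ideal only has to be tested on generators,
    as preimages commute with finite unions. *)
Lemma preimage_generated_by (Y : Type) (f : X -> Y) (G : set (set Y)) :
  (forall B, G B -> I (f @^-1` B)) ->
  forall A, generated_by G A -> I (f @^-1` A).
Proof.
move=> IG A [F [finF FG AF]].
apply: (@ideal_sub _ _ hI _ (\bigcup_(B in F) f @^-1` B)); last first.
  by apply: (@ideal_bigcup (set Y)) => // B /FG /IG.
by rewrite -preimage_bigcup; apply: preimage_subset.
Qed.

End Ideals.

Lemma WR_vertical_line n : WR (vertical_line n).
Proof.
exists [set vertical_line n]; split=> //; last by rewrite bigcup_set1.
by move=> _ ->; left; exists n.
Qed.

Lemma WR_of_scattered G : WR_scattered G -> WR G.
Proof.
move=> scG; exists [set G]; split=> //; last by rewrite bigcup_set1.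
by move=> _ ->; right.
Qed.

(** * Building infinite sequences *)

Lemma mem_mkseq_lt (X : eqType) (b : nat -> X) i k : i < k -> b i \in mkseq b k.
Proof. by move=> ik; apply/mapP; exists i; rewrite ?mem_iota. Qed.

Lemma infinite_range (Y : Type) (b : nat -> Y) :
  injective b -> infinite_set (range b).
Proof.
move=> binj; have rb : (range b #= [set: nat])%card.
  by apply: inj_card_eq => i j _ _ /binj.
by rewrite (eq_finite_set rb); exact: infinite_nat.
Qed.

(** Dependent choice over finite sequences, in the form that produces branches:
    [Q] holds of the nodes built so far. *)
Lemma infinite_extension (X : Type) (Q : seq X -> Prop) :
  Q [::] -> (forall s, Q s -> exists x, Q (rcons s x)) ->
  exists b : nat -> X, forall k, Q (mkseq b k).
Proof.
move=> Q0 QS.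
have [x0 _] := QS _ Q0.
have /choice[nxt nxtP] s : exists x, Q s -> Q (rcons s x).
  have [/QS[x Qx]|nQ] := pselect (Q s); first by exists x.
  by exists x0.
pose st k := iter k (fun s => rcons s (nxt s)) [::].
exists (fun k => nxt (st k)) => k.
suff -> : mkseq (fun k => nxt (st k)) k = st k.
  by elim: k => //= k; exact: nxtP.
by elim: k => // k IHk; rewrite mkseqS IHk.
Qed.

(** The finite sequences that are prolonged at each step are the duplicate-free
    ones listing an initial segment of [S] for the order induced by [lev]: a
    point of [S] outside the segment and of minimal level prolongs it. An
    element of [S] never listed would bound the strictly increasing levels of
    the sequence. *)
Lemma increasing_enumeration (X : choiceType) (S : set X) (lev : X -> nat) :
  infinite_set S -> (forall x y, S x -> S y -> lev x = lev y -> x = y) ->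
  exists b : nat -> X,
    range b = S /\ forall i j, i < j -> lev (b i) < lev (b j).
Proof.
move=> infS levI.
pose Q s := [/\ uniq s, forall x, x \in s -> S x &
  forall x y, x \in s -> S y -> lev y <= lev x -> y \in s].
have [||b Qb] := @infinite_extension _ Q.
- by split.
- move=> s [us sS ds].
  pose P n := `[< exists x, [/\ S x, x \notin s & lev x = n] >].
  have exP : exists n, P n.
    have [] : S `\` [set` s] !=set0 by apply/infinite_setN0/infinite_setD.
    by move=> x [Sx /negP sx]; exists (lev x); apply/asboolP; exists x.
  case: (ex_minnP exP) => _ /asboolP[x [Sx sx <-]] xmin; exists x; split.
  + by rewrite rcons_uniq sx.
  + by move=> y; rewrite mem_rcons in_cons => /orP[/eqP->|/sS].
  + move=> z y; rewrite !mem_rcons !in_cons => zsx Sy yz.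
    have [|sy] := boolP (y \in s); first by rewrite orbT.
    have xy : lev x <= lev y by apply: xmin; apply/asboolP; exists y.
    case/orP: zsx => [/eqP zx|zs].
      by rewrite (levI y x) ?eqxx//; apply/eqP; rewrite eqn_leq xy -zx yz.
    by rewrite (ds _ _ zs Sy yz) in sy.
have bS k : S (b k).
  by have [_ sS _] := Qb k.+1; apply/sS/mem_mkseq_lt.
have blt i j : i < j -> lev (b i) < lev (b j).
  move=> ij; rewrite ltnNge; apply/negP => ji.
  have [_ _ /(_ (b i) (b j) (mem_mkseq_lt b ij) (bS j) ji) jj] := Qb j.
  by have [] := Qb j.+1; rewrite mkseqS rcons_uniq jj.
exists b; split=> //; apply/seteqP; split=> [_ [k _ <-]//|y Sy].
apply: contrapT => yb.
have ylt k : lev (b k) < lev y.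
  rewrite ltnNge; apply/negP => yk.
  have [_ _ /(_ (b k) y (mem_mkseq_lt b (ltnSn k)) Sy yk)] := Qb k.+1.
  by case/mapP => i _ yi; apply: yb; exists i.
have kle k : k <= lev (b k).
  by elim: k => // k IHk; apply: leq_ltn_trans IHk (blt _ _ (ltnSn k)).
by have := leq_ltn_trans (kle (lev y)) (ylt (lev y)); rewrite ltnn.
Qed.

(** * A Katetov reduction gives a tree without positive branches *)

Lemma katetov_le_not_weakly_ramsey (X : eqType) (I : set (set X)) :
  is_ideal I -> katetov_le WR I -> ~ weakly_ramsey I.
Proof.
move=> hI [f If] wrI.
pose climb x y := (f x).1 + (f x).2 < (f y).1.
have [||b [Tb]] := wrI [set s | pairwise climb s].
- split; first by exists [::].
  by move=> s _ /prefixP[t ->] /=; rewrite pairwise_cat => /and3P[].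
- move=> s /= Ts.
  (* A point whose image has first coordinate above m prolongs s. *)
  pose m := \max_(x <- s) ((f x).1 + (f x).2).
  apply: (@ideal_sub _ _ hI _ (\bigcup_(n in `I_m.+1) f @^-1` vertical_line n)).
    move=> x /= /negP; rewrite pairwise_rcons Ts andbT => nx.
    exists (f x).1 => //=; rewrite ltnS leqNgt; apply: contra nx => mx.
    apply/allP => y sy; apply: leq_ltn_trans mx.
    exact: (@leq_bigmax_seq _ s xpredT (fun x => (f x).1 + (f x).2) y).
  apply: (ideal_bigcup hI); first exact: finite_II.
  by move=> n _; apply/If/WR_vertical_line.
apply; apply: (@ideal_sub _ _ hI _ (f @^-1` (f @` range b))).
  by move=> x bx; exists x.
apply/If/WR_of_scattered.
have climbb i j : i < j -> climb (b i) (b j).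
  move=> ij; have : pairwise climb (mkseq b j.+1) := Tb j.
  rewrite mkseqS pairwise_rcons => /andP[/allP + _].
  by apply; apply: mem_mkseq_lt.
move=> _ _ [_ [i _ <-] <-] [_ [j _ <-] <-] fij.
case: (ltngtP i j) => [ij|ji|ij]; last by rewrite ij in fij.
  by right; apply: climbb.
by left; apply: climbb.
Qed.

(** * A tree without positive branches gives a copy *)

Section TreeWithoutPositiveBranch.
Variables (X : countType) (I : set (set X)) (T : set (seq X)).
Hypothesis hI : is_ideal I.
Hypothesis T_nil : T [::].
Hypothesis T_ram : forall s, T s -> dual_filter I (ramification T s).
Hypothesis T_branch : forall b, is_branch T b -> I (range b).

(** Ramifications are infinite, so a branch can be chosen without repetitions;
    its range is then infinite, and in [I] because no branch is positive. *)
Lemma ideal_has_infinite_set : exists2 C, I C & infinite_set C.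
Proof.
have [||b Qb] := @infinite_extension _ (fun s => T s /\ uniq s).
- by split.
- move=> s [Ts us].
  have [x [Tx /negP sx]] : ramification T s `\` [set` s] !=set0.
    apply/infinite_setN0/infinite_setD => //.
    exact: (dual_filter_infinite hI (T_ram Ts)).
  by exists x; rewrite rcons_uniq us sx.
exists (range b).
  by apply: T_branch => k; have [] := Qb k.+1.
apply: infinite_range => i j bij; have [_ /mkseq_uniqP] := Qb (maxn i j).+1.
by apply; rewrite // inE ltnS ?leq_maxl ?leq_maxr.
Qed.

Lemma mem_pmap_unpickle n x :
  pickle x <= n -> x \in pmap (@unpickle X) (iota 0 n.+1).
Proof.
move=> xn; rewrite mem_pmap; apply/mapP; exists (pickle x).
  by rewrite mem_iota add0n ltnS.
by rewrite pickleK.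
Qed.

(** The nodes considered at stage [n]. All that matters is that they are
    finitely many, that they increase with [n], and that prolonging one of them
    by a point of index at most [n] gives a node considered at stage [n.+1]. *)
Fixpoint words n : seq (seq X) :=
  if n is k.+1 then
    words k ++ [seq rcons s x | s <- words k, x <- pmap unpickle (iota 0 n)]
  else [:: [::]].

Lemma words_mono m n : m <= n -> {subset words m <= words n}.
Proof.
move=> /subnKC <-; elim: (n - m) => [|k IHk] s sm; first by rewrite addn0.
by rewrite addnS /= mem_cat IHk.
Qed.

Lemma words_rcons n s x :
  s \in words n -> pickle x <= n -> rcons s x \in words n.+1.
Proof.
move=> sn xn; rewrite [words _]/= mem_cat; apply/orP; right.
apply/allpairsP; exists (s, x); split=> //.
exact: mem_pmap_unpickle.
Qed.

(** The disjunct on [pickle x] makes every point discarded at some stage, even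
    if it prolongs all the nodes of [T]. *)
Definition discarded n x : Prop :=
  pickle x <= n \/ exists s, [/\ s \in words n, T s & ~ T (rcons s x)].

Lemma ideal_discarded n : I (discarded n).
Proof.
apply: (ideal_setU hI); last first.
  have finF : finite_set ([set` words n] `&` T) by apply: finite_setIl.
  apply: (ideal_sub hI _ (ideal_bigcup hI finF (fun s sF => T_ram sF.2))).
  by move=> x [s [sn Ts Tx]]; exists s.
apply: (ideal_finite hI).
apply: (@sub_finite_set _ _ [set` pmap (@unpickle X) (iota 0 n.+1)]) => //.
by move=> x xn; exact: mem_pmap_unpickle.
Qed.

Lemma discarded_eventually x : exists n, `[< discarded n x >].
Proof. by exists (pickle x); apply/asboolP; left. Qed.

Definition level x := ex_minn (discarded_eventually x).

Lemma discarded_level x : discarded (level x) x.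
Proof. by rewrite /level; case: ex_minnP => n /asboolP. Qed.

Lemma lt_level_extends n s x :
  n < level x -> s \in words n -> T s -> T (rcons s x).
Proof.
rewrite /level; case: ex_minnP => m _ min_m nm sn Ts.
apply: contrapT => nT; move: nm; rewrite ltnNge => /negP; apply.
by apply: min_m; apply/asboolP; right; exists s.
Qed.

Definition level_map x := (level x, pickle x).

Lemma level_map_inj : injective level_map.
Proof. by move=> x y [_ /(pcan_inj pickleK)]. Qed.

Lemma ideal_level n : I (level_map @^-1` vertical_line n).
Proof.
apply: (ideal_sub hI _ (ideal_discarded n)) => x <-.
exact: discarded_level.
Qed.

(** The invariant is that the first [k] points form a node considered at a stage
    below the level of the next point. The first level has to be positive
    because a point of level 0 need not prolong even the empty sequence. *)
Lemma climbing_is_branch b :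
  0 < level (b 0) ->
  (forall k, level (b k) + pickle (b k) < level (b k.+1)) ->
  is_branch T b.
Proof.
move=> b0 climb.
have lev_gt0 k : 0 < level (b k).
  by case: k => // k; apply: leq_ltn_trans (climb k).
suff Hb k : mkseq b k \in words (level (b k)).-1 /\ T (mkseq b k).
  by move=> k; have [] := Hb k.+1.
elim: k => [|k [wk Tk]].
  by split=> //; apply: (@words_mono 0).
rewrite mkseqS; split; last by apply: lt_level_extends wk Tk; rewrite prednK.
apply: (@words_mono ((level (b k)).-1 + pickle (b k)).+1).
  by rewrite -addSn prednK// -ltnS prednK.
apply: words_rcons; last exact: leq_addl.
by apply: words_mono wk; exact: leq_addr.
Qed.

(** Level 0 contributes a set of [I]; the rest of the preimage is either finite
    or, listed by increasing level, the range of a branch. *)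
Lemma ideal_scattered G : WR_scattered G -> I (level_map @^-1` G).
Proof.
move=> scG; pose S := [set x | G (level_map x) /\ 0 < level x].
apply: (@ideal_sub _ _ hI _ (level_map @^-1` vertical_line 0 `|` S)).
  move=> x Gx; case: (posnP (level x)) => lx; first by left.
  by right; split.
apply: (ideal_setU hI); first exact: ideal_level.
have [finS|infS] := pselect (finite_set S); first exact: (ideal_finite hI).
have scS x y : S x -> S y -> x <> y ->
    level y + pickle y < level x \/ level x + pickle x < level y.
  by move=> [Gx _] [Gy _] xy; apply: (scG _ _ Gx Gy) => /level_map_inj.
have lev_inj x y : S x -> S y -> level x = level y -> x = y.
  move=> Sx Sy lxy; apply: contrapT => /(scS _ _ Sx Sy).
  by rewrite lxy !ltnNge !leq_addr; case.
have [b [rb lev_lt]] := increasing_enumeration infS lev_inj.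
have bS k : S (b k) by rewrite -rb; exists k.
rewrite -rb; apply/T_branch/climbing_is_branch; first by have [] := bS 0.
move=> k; have lk := lev_lt _ _ (ltnSn k).
have [|lt|//] := scS (b k) (b k.+1) (bS _) (bS _).
  by move=> bk; rewrite -bk ltnn in lk.
by have := ltn_trans (leq_ltn_trans (leq_addr _ _) lt) lk; rewrite ltnn.
Qed.

(** Changing the map on [C] enlarges preimages by at most [C], which is in [I],
    so only a bijection between [C] and [D], both countably infinite, is
    needed. *)
Lemma contains_copy_WR : contains_copy WR I.
Proof.
have [C IC infC] := ideal_has_infinite_set.
pose D := ~` (level_map @` (~` C)).
have infD : infinite_set D.
  (* Second coordinates are indices, so at most one of (0, m) and (1, m) is an
     image, and D contains the other. *)
  pose d m := (if `[< (level_map @` (~` C)) (0, m) >] then 1 else 0, m).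
  apply: (@sub_infinite_set _ (range d)); last first.
    by apply: infinite_range => m n [].
  move=> _ [m _ <-]; rewrite /d; case: asboolP => // -[x _ [lx px]] [y _ [ly py]].
  have xy : x = y by apply: (pcan_inj pickleK); rewrite px py.
  by rewrite xy ly in lx.
have /card_set_bijP[h [hCD hinj hsurj]] : (C #= D)%card.
  apply: card_eq_trans (eq_card_nat (countableP C) infC) _.
  by rewrite card_eq_sym; exact: eq_card_nat.
pose g x := if `[< C x >] then h x else level_map x.
have gC x : C x -> g x = h x by move=> Cx; rewrite /g asboolT.
have gN x : ~ C x -> g x = level_map x by move=> Cx; rewrite /g asboolF.
exists g.
  rewrite -setTT_bijective; split=> //.
    move=> x y _ _.
    have [Cx|Cx] := pselect (C x); have [Cy|Cy] := pselect (C y).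
    - by rewrite !gC// => /hinj; apply; rewrite inE.
    - rewrite gC// gN// => xy; case: (hCD _ Cx); exists y => //.
    - rewrite gN// gC// => xy; case: (hCD _ Cy); exists x => //.
    - by rewrite !gN// => /level_map_inj.
  move=> p _; have [Dp|] := pselect (D p).
    by have [x Cx <-] := hsurj _ Dp; exists x; rewrite ?gC.
  by move=> /contrapT[x Cx <-]; exists x; rewrite ?gN.
apply: (preimage_generated_by hI) => A GA.
apply: (@ideal_sub _ _ hI _ (level_map @^-1` A `|` C)).
  move=> x; have [Cx|Cx] := pselect (C x); first by right.
  by rewrite /preimage /= gN//; left.
apply: (ideal_setU hI) => //.
case: GA => [[n _ <-]|]; first exact: ideal_level.
exact: ideal_scattered.
Qed.

End TreeWithoutPositiveBranch.

Lemma not_weakly_ramsey_contains_copy (X : countType) (I : set (set X)) :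
  is_ideal I -> ~ weakly_ramsey I -> contains_copy WR I.
Proof.
move=> hI nwr; apply: contrapT => ncopy; apply: nwr => T [[s Ts] T_pre] T_ram.
apply: contrapT => nbranch; apply: ncopy.
apply: (@contains_copy_WR _ _ T) => //.
  by apply: T_pre Ts; exact: prefix0s.
by move=> b Tb; apply: contrapT => Ib; apply: nbranch; exists b.
Qed.

Theorem theorem1p3 (X : countType) (I : set (set X)) (hI : is_ideal I) :
  (~ weakly_ramsey I <-> contains_copy WR I) /\
  (contains_copy WR I <-> katetov_le WR I).
Proof.
have copy_le : contains_copy WR I -> katetov_le WR I by case=> f _ If; exists f.
have copyP := not_weakly_ramsey_contains_copy hI.
have leP := katetov_le_not_weakly_ramsey hI.
split; split=> //; first by move=> /copy_le /leP.
by move=> /leP /copyP.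
Qed.
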